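(* Let $f=(f_1,\dots,f_{n_x}):\mathcal Z\to\mathbb R^{n_x}$ have ELLC components with known Clarke-derivative bounds $a_{ij},b_{ij}$, in the discrete-time (DT) or continuous-time (CT) setting. Let $f_d^L=(f^L_{d,1},\dots,f^L_{d,n_x})$, $T_L^{f_d}$ and $T_R^{f_d}$ be as defined in the context. Then: (i) $f_d^L$ belongs to the family of remainder-form decomposition functions: for each $i\in\mathbb N_{n_x}$ there exist $\mathbf m_i^L\in\mathbf M_i$ and a corresponding remainder function $h_i^L\in\mathcal H_{\mathbf M_i}$ such that $f^L_{d,i}(\cdot,\cdot)=f_{d,i}(\cdot,\cdot;\mathbf m_i^L,h_i^L)$. (ii) $T_R^{f_d}$ is always at least as tight as $T_L^{f_d}$: $T_R^{f_d}(\mathbb I\mathcal Z)\subseteq T_L^{f_d}(\mathbb I\mathcal Z)$ for every interval $\mathbb I\mathcal Z=[\underline z,\overline z]\subset\mathcal Z$.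
   Context: Notation: $\mathbb N_n=\{1,\dots,n\}$; inequalities between vectors are componentwise; $[\underline z,\overline z]=\{z:\underline z\le z\le\overline z\}$. $\mathcal Z\subset\mathbb R^{n_z}$ is a box (product of intervals). Topological notions are relative to $\mathcal Z$, and difference quotients use points of $\mathcal Z$. The system is $x_t^+=f(z_t)$, $z_t=(x_t,w_t)\in\mathcal Z$, $n_x\le n_z$, with $x_t^+=x_{t+1}$ (DT) or $x_t^+=\dot x_t$ (CT). In the CT case, for component $i$ of an inclusion function the interval argument is replaced by the interval with the same $j$-th coordinates, $j\ne i$, and with $\underline z_i=\overline z_i=x_i$ a fixed value. ELLC: $\varphi:\mathcal Z\to\mathbb R$ is either-sided locally Lipschitz continuous if for every $z\in\mathcal Z$ there are an open neighborhood $\mathcal N_z$ of $z$, a vector $\kappa\in\mathbb R^{n_z}$ with all entries nonzero, and $\rho\in\mathbb R$ such that $\langle\kappa(\varphi(z')-\varphi(z'')),z'-z''\rangle\le\rho\|z'-z''\|_2^2$ for all $z',z''\in\mathcal N_z$. Clarke derivatives: $(\overline J^{\varphi}_C(z))_j=\limsup_{t\to z,\lambda\downarrow0}\frac{\varphi(t+\lambda e_j)-\varphi(t)}{\lambda}$ and $(\underline J^{\varphi}_C(z))_j=\liminf_{t\to z,\lambda\downarrow0}\frac{\varphi(t+\lambda e_j)-\varphi(t)}{\lambda}$, with $e_j$ the $j$-th standard unit vector. Bounds: $a_{ij}\in\mathbb R\cup\{-\infty\}$, $b_{ij}\in\mathbb R\cup\{+\infty\}$, not both infinite for any $(i,j)$,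 satisfy $a_{ij}\le(\underline J_C^{f_i}(z))_j$ and $(\overline J_C^{f_i}(z))_j\le b_{ij}$ for all $z\in\mathcal Z$. Put $p_{ij}=\min(a_{ij},0)$ and $r_{ij}=\max(b_{ij},0)$. Supporting vectors: DT: $\mathbf M_i=\{\mathbf m\in\mathbb R^{n_z}:\forall j,\ \mathbf m_j\ge r_{ij}\text{ or }\mathbf m_j\le p_{ij}\}$ and $\mathbf M_i^c=\{\mathbf m\in\mathbb R^{n_z}:\forall j,\ \mathbf m_j=r_{ij}\text{ or }\mathbf m_j=p_{ij}\}$. CT: the same with the conditions imposed for $j\ne i$ only, and $\mathbf m_i=0$. Corner map: $\zeta_{\mathbf m,j}(z,\hat z)=\hat z_j$ if $\mathbf m_j\ge r_{ij}$, and $=z_j$ otherwise; in the CT case $\zeta_{\mathbf m,i}=x_i$, where $x_i$ is the $i$-th coordinate of the first argument of the decomposition function being evaluated. Remainder functions: $\mathcal H_{\mathbf M_i}$ is the set of ELLC $h:\mathcal Z\to\mathbb R$ with $[\underline J_C^h(z),\overline J_C^h(z)]\subseteq\mathbf M_i$ for all $z\in\mathcal Z$. $h\in\mathcal H_{\mathbf M_i}$ corresponds to $\mathbf m\in\mathbf M_i$ if for each $j$ (with $j\neq i$ in the CT case): when $\mathbf m_j\ge r_{ij}$, $(\underline J_C^h(z))_j\ge r_{ij}$ for all $z\in\mathcal Z$; otherwise $(\overline J_C^h(z))_j\le p_{ij}$ for all $z\in\mathcal Z$. Family: $f_{d,i}(z,\hat z;\mathbf m,h)=h(\zeta_{\mathbf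 m}(\hat z,z))+f_i(\zeta_{\mathbf m}(z,\hat z))-h(\zeta_{\mathbf m}(z,\hat z))$. $T_R^{f_d}(\mathbb I\mathcal Z)$ has $i$-th component $[\underline f_{d,i}(\underline z,\overline z),\overline f_{d,i}(\overline z,\underline z)]$ with, for $\zeta^+_{\mathbf m}=\zeta_{\mathbf m}(\overline z,\underline z)$ and $\zeta^-_{\mathbf m}=\zeta_{\mathbf m}(\underline z,\overline z)$, $\overline f_{d,i}(\overline z,\underline z)=\min_{\mathbf m\in\mathbf M_i^c}f_i(\zeta^+_{\mathbf m})+\mathbf m^\top(\zeta^-_{\mathbf m}-\zeta^+_{\mathbf m})$ and $\underline f_{d,i}(\underline z,\overline z)=\max_{\mathbf m\in\mathbf M_i^c}f_i(\zeta^-_{\mathbf m})+\mathbf m^\top(\zeta^+_{\mathbf m}-\zeta^-_{\mathbf m})$. The decomposition function $f^L_d$: $f^L_{d,i}(z,\hat z)=f_i(\zeta)+(\alpha_i-\beta_i)(z-\hat z)$ with row vectors $\alpha_i,\beta_i$ and a point $\zeta$ determined for each $j$ by the first applicable case (Case 5, used only in the CT case, has precedence): Case 5, $j=i$: $\alpha_{ij}=\beta_{ij}=0$, $\zeta_j=x_i$. Case 1, $a_{ij}\ge0$: $\alpha_{ij}=\beta_{ij}=0$, $\zeta_j=z_j$. Case 2, $a_{ij}\le0\le b_{ij}$, $|a_{ij}|\le|b_{ij}|$: $\alpha_{ij}=|a_{ij}|$, $\beta_{ij}=0$, $\zeta_j=z_j$. Case 3, $a_{ij}\le0\le b_{ij}$,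 $|a_{ij}|\ge|b_{ij}|$: $\alpha_{ij}=0$, $\beta_{ij}=-|b_{ij}|$, $\zeta_j=\hat z_j$. Case 4, $b_{ij}\le0$: $\alpha_{ij}=\beta_{ij}=0$, $\zeta_j=\hat z_j$. Finally $T_L^{f_d}(\mathbb I\mathcal Z)=[f_d^L(\underline z,\overline z),f_d^L(\overline z,\underline z)]$. *)

(* Defs.v *)
(* MathComp-Analysis *)
From HB Require Import structures.
From mathcomp Require Import all_boot all_order all_algebra.
From mathcomp Require Import all_classical all_reals all_analysis.

Set Implicit Arguments.
Unset Strict Implicit.
Unset Printing Implicit Defensive.

Import Order.TTheory GRing.Theory Num.Theory.
Import numFieldNormedType.Exports.

Local Open Scope classical_set_scope.
Local Open Scope ring_scope.

(* Functions on a box Z are represented by total functions on 'rV[R]_n that are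
   only ever inspected at points of Z. *)
Definition box (R : realType) (n : nat) (B : 'I_n -> interval R)
  : set 'rV[R]_n :=
  [set z | forall j, z 0 j \in B j].

Definition vec_itv (R : realType) (n : nat) (zl zu : 'rV[R]_n)
  : set 'rV[R]_n :=
  [set z | forall j, zl 0 j <= z 0 j <= zu 0 j].

Definition component (R : realType) (nx nz : nat)
    (f : 'rV[R]_nz -> 'rV[R]_nx) (i : 'I_nx) (z : 'rV[R]_nz) : R := f z 0 i.

Definition dotp (R : realType) (n : nat) (u v : 'rV[R]_n) : R :=
  \sum_j u 0 j * v 0 j.

Definition ellc (R : realType) (n : nat) (Z : set 'rV[R]_n)
    (phi : 'rV[R]_n -> R) : Prop :=
  forall z, Z z ->
  exists (N : set 'rV[R]_n) (kappa : 'rV[R]_n) (rho : R),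
    [/\ open_nbhs z N,
        (forall j, kappa 0 j != 0) &
        forall z' z'', (N `&` Z) z' -> (N `&` Z) z'' ->
          dotp ((phi z' - phi z'') *: kappa) (z' - z'')
            <= rho * dotp (z' - z'') (z' - z'')].

(* The filter "t --> z, lambda --> 0+", restricted to the pairs (t, lambda) for
   which both points of the difference quotient lie in Z; t = z is allowed. *)
Definition clarke_filter (R : realType) (n : nat) (Z : set 'rV[R]_n)
    (z : 'rV[R]_n) (j : 'I_n) : set_system ('rV[R]_n * R) :=
  within [set p | Z p.1 /\ Z (p.1 + p.2 *: delta_mx 0 j)]
         (filter_prod (nbhs z) (0^'+)).

Definition diff_quot (R : realType) (n : nat) (phi : 'rV[R]_n -> R) (j : 'I_n)
    (p : 'rV[R]_n * R) : \bar R :=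
  ((phi (p.1 + p.2 *: delta_mx 0 j) - phi p.1) / p.2)%:E.

Definition clarke_up (R : realType) (n : nat) (Z : set 'rV[R]_n)
    (phi : 'rV[R]_n -> R) (z : 'rV[R]_n) (j : 'I_n) : \bar R :=
  limf_esup (diff_quot phi j) (clarke_filter Z z j).

Definition clarke_low (R : realType) (n : nat) (Z : set 'rV[R]_n)
    (phi : 'rV[R]_n -> R) (z : 'rV[R]_n) (j : 'I_n) : \bar R :=
  limf_einf (diff_quot phi j) (clarke_filter Z z j).

Inductive time_setting := DT | CT.

(* From here on, k : 'I_n is the index of the component of f under
   consideration, seen as a coordinate of z, and a, b : 'I_n -> \bar R are the
   bounds for that component. In continuous time coordinate k plays a special
   role; in discrete time k is irrelevant. *)
Definition special (tm : time_setting) (n : nat) (k j : 'I_n) : bool :=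
  if tm is CT then j == k else false.

Definition pbnd (R : realType) (n : nat) (a : 'I_n -> \bar R) (j : 'I_n)
  : \bar R := Order.min (a j) 0%E.

Definition rbnd (R : realType) (n : nat) (b : 'I_n -> \bar R) (j : 'I_n)
  : \bar R := Order.max (b j) 0%E.

Definition supp_vec (R : realType) (tm : time_setting) (n : nat) (k : 'I_n)
    (a b : 'I_n -> \bar R) : set 'rV[R]_n :=
  [set m | forall j,
     if special tm k j then m 0 j = 0
     else (rbnd b j <= (m 0 j)%:E)%E \/ ((m 0 j)%:E <= pbnd a j)%E].

Definition supp_vec_c (R : realType) (tm : time_setting) (n : nat) (k : 'I_n)
    (a b : 'I_n -> \bar R) : set 'rV[R]_n :=
  [set m | forall j,
     if special tm k j then m 0 j = 0
     else (m 0 j)%:E = rbnd b j \/ (m 0 j)%:E = pbnd a j].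

(* The value xk is a separate argument because it is the k-th coordinate of the
   first argument of the decomposition function being evaluated, also when the
   corner map itself is applied to the swapped pair. *)
Definition corner (R : realType) (tm : time_setting) (n : nat) (k : 'I_n)
    (b : 'I_n -> \bar R) (xk : R) (m z zh : 'rV[R]_n) : 'rV[R]_n :=
  \row_j (if special tm k j then xk
          else if (rbnd b j <= (m 0 j)%:E)%E then zh 0 j else z 0 j).

Definition remainder_fun (R : realType) (tm : time_setting) (n : nat)
    (k : 'I_n) (Z : set 'rV[R]_n) (a b : 'I_n -> \bar R)
    (h : 'rV[R]_n -> R) : Prop :=
  ellc Z h /\
  forall z, Z z ->
    [set v : 'rV[R]_n | forall j,
       (clarke_low Z h z j <= (v 0 j)%:E <= clarke_up Z h z j)%E]
    `<=` supp_vec tm k a b.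

Definition corresponds (R : realType) (tm : time_setting) (n : nat)
    (k : 'I_n) (Z : set 'rV[R]_n) (a b : 'I_n -> \bar R)
    (h : 'rV[R]_n -> R) (m : 'rV[R]_n) : Prop :=
  forall j, ~~ special tm k j ->
    if (rbnd b j <= (m 0 j)%:E)%E
    then forall z, Z z -> (rbnd b j <= clarke_low Z h z j)%E
    else forall z, Z z -> (clarke_up Z h z j <= pbnd a j)%E.

Definition fd (R : realType) (tm : time_setting) (n : nat) (k : 'I_n)
    (b : 'I_n -> \bar R) (phi : 'rV[R]_n -> R)
    (m : 'rV[R]_n) (h : 'rV[R]_n -> R) (z zh : 'rV[R]_n) : R :=
  h (corner tm k b (z 0 k) m zh z) + phi (corner tm k b (z 0 k) m z zh)
  - h (corner tm k b (z 0 k) m z zh).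

Definition fR_val (R : realType) (tm : time_setting) (n : nat) (k : 'I_n)
    (b : 'I_n -> \bar R) (phi : 'rV[R]_n -> R) (z zh m : 'rV[R]_n) : R :=
  phi (corner tm k b (z 0 k) m z zh)
  + dotp m (corner tm k b (z 0 k) m zh z - corner tm k b (z 0 k) m z zh).

(* supp_vec_c is finite, and nonempty as soon as no a j, b j are both infinite,
   so that this inf (resp. sup) is a minimum (resp. maximum). *)
Definition fR_up (R : realType) (tm : time_setting) (n : nat) (k : 'I_n)
    (a b : 'I_n -> \bar R) (phi : 'rV[R]_n -> R) (z zh : 'rV[R]_n) : R :=
  inf [set fR_val tm k b phi z zh m | m in supp_vec_c tm k a b].

Definition fR_low (R : realType) (tm : time_setting) (n : nat) (k : 'I_n)
    (a b : 'I_n -> \bar R) (phi : 'rV[R]_n -> R) (z zh : 'rV[R]_n) : R :=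
  sup [set fR_val tm k b phi z zh m | m in supp_vec_c tm k a b].

Inductive Lcase :=
  | Lcase1   (* 0 <= a *)
  | Lcase2   (* a <= 0 <= b, |a| <= |b| *)
  | Lcase3   (* a <= 0 <= b, |b| <= |a| *)
  | Lcase4   (* b <= 0 *)
  | Lcase5.  (* the special coordinate *)

(* When the first four tests fail, b j <= 0 necessarily holds. *)
Definition Lcase_of (R : realType) (tm : time_setting) (n : nat) (k : 'I_n)
    (a b : 'I_n -> \bar R) (j : 'I_n) : Lcase :=
  if special tm k j then Lcase5
  else if (0 <= a j)%E then Lcase1
  else if [&& (a j <= 0)%E, (0 <= b j)%E & (`|a j| <= `|b j|)%E] then Lcase2
  else if [&& (a j <= 0)%E, (0 <= b j)%E & (`|b j| <= `|a j|)%E] then Lcase3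
  else Lcase4.

(* In Lcase2 (resp. Lcase3) a j (resp. b j) is finite, unless both a j and b j
   are infinite, so that [fine] loses nothing. *)
Definition Lalpha (R : realType) (tm : time_setting) (n : nat) (k : 'I_n)
    (a b : 'I_n -> \bar R) : 'rV[R]_n :=
  \row_j (if Lcase_of tm k a b j is Lcase2 then fine `|a j|%E else 0).

Definition Lbeta (R : realType) (tm : time_setting) (n : nat) (k : 'I_n)
    (a b : 'I_n -> \bar R) : 'rV[R]_n :=
  \row_j (if Lcase_of tm k a b j is Lcase3 then - fine `|b j|%E else 0).

Definition Lzeta (R : realType) (tm : time_setting) (n : nat) (k : 'I_n)
    (a b : 'I_n -> \bar R) (z zh : 'rV[R]_n) : 'rV[R]_n :=
  \row_j match Lcase_of tm k a b j with
         | Lcase1 | Lcase2 => z 0 j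
         | Lcase3 | Lcase4 => zh 0 j
         | Lcase5 => z 0 k
         end.

Definition fL (R : realType) (tm : time_setting) (n : nat) (k : 'I_n)
    (a b : 'I_n -> \bar R) (phi : 'rV[R]_n -> R) (z zh : 'rV[R]_n) : R :=
  phi (Lzeta tm k a b z zh)
  + dotp (Lalpha tm k a b - Lbeta tm k a b) (z - zh).

(* In continuous time, the k-th coordinate of the endpoints of an interval
   argument is replaced by the fixed value xk. *)
Definition itv_arg (R : realType) (tm : time_setting) (n : nat) (k : 'I_n)
    (xk : R) (z : 'rV[R]_n) : 'rV[R]_n :=
  \row_j (if special tm k j then xk else z 0 j).

(* The vector x of fixed values is irrelevant in discrete time. *)
Definition TR (R : realType) (tm : time_setting) (nx nz : nat)
    (le_n : (nx <= nz)%N) (a b : 'I_nx -> 'I_nz -> \bar R)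
    (f : 'rV[R]_nz -> 'rV[R]_nx) (x : 'rV[R]_nx) (zl zu : 'rV[R]_nz)
  : set 'rV[R]_nx :=
  vec_itv
    (\row_i (let k := widen_ord le_n i in
             fR_low tm k (a i) (b i) (component f i)
               (itv_arg tm k (x 0 i) zl) (itv_arg tm k (x 0 i) zu)))
    (\row_i (let k := widen_ord le_n i in
             fR_up tm k (a i) (b i) (component f i)
               (itv_arg tm k (x 0 i) zu) (itv_arg tm k (x 0 i) zl))).

Definition TL (R : realType) (tm : time_setting) (nx nz : nat)
    (le_n : (nx <= nz)%N) (a b : 'I_nx -> 'I_nz -> \bar R)
    (f : 'rV[R]_nz -> 'rV[R]_nx) (x : 'rV[R]_nx) (zl zu : 'rV[R]_nz)
  : set 'rV[R]_nx :=
  vec_itv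
    (\row_i (let k := widen_ord le_n i in
             fL tm k (a i) (b i) (component f i)
               (itv_arg tm k (x 0 i) zl) (itv_arg tm k (x 0 i) zu)))
    (\row_i (let k := widen_ord le_n i in
             fL tm k (a i) (b i) (component f i)
               (itv_arg tm k (x 0 i) zu) (itv_arg tm k (x 0 i) zl))).

(* Main.v *)
(* The linear function h with slope a_j in Case 2, b_j in Case 3 and 0 elsewhere
   is a remainder function, and its family member is f_d^L as soon as the corner
   selected by m is the point zeta of f_d^L; this gives (i).
   For (ii) the slope of h is itself a vector of M^c, so that its value bounds
   the min (resp. max) defining T_R. Its corner can differ from zeta only in
   coordinates with a_j >= 0, along which f_i is nondecreasing: a nonnegative
   lower Clarke derivative gives f_i(t + l e_j) - f_i(t) >= - e l near each point
   of the segment, and these local increments add up. *)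
Require Import Defs.
From HB Require Import structures.
From mathcomp Require Import all_boot all_order all_algebra.
From mathcomp Require Import all_classical all_reals all_analysis.
From mathcomp Require Import ring lra.

Import Order.TTheory GRing.Theory Num.Theory.
Import numFieldNormedType.Exports.

Set Implicit Arguments.
Unset Strict Implicit.

Local Open Scope classical_set_scope.
Local Open Scope ring_scope.

(** * Monotonicity from a nonnegative lower Clarke derivative *)

(** Continuous induction on the set of [s] whose increment from 0 is at least [c * s]. A priori the
    supremum need not belong to this set; since the local bound holds for every base point [t] near
    [s], a step can start just below the supremum and pass it. *)
Lemma local_to_global_increment (R : realType) (g : R -> R) (T c : R) :
  0 <= T ->
  (forall s, 0 <= s <= T -> exists2 d, 0 < d &
     forall t l, `|t - s| < d -> 0 < l < d -> 0 <= t -> t + l <= T ->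
       c * l <= g (t + l) - g t) ->
  c * T <= g T - g 0.
Proof.
move=> T0 loc.
pose S := [set s | 0 <= s <= T /\ c * s <= g s - g 0].
have S0 : S 0 by split; [rewrite lexx | rewrite subrr mulr0].
have ubS : has_ubound S by exists T => s [/andP[]].
have supS : has_sup S by split; first by exists 0.
have sT : 0 <= sup S <= T.
  by rewrite ub_le_sup//= ge_sup//; [exists 0 | move=> s [/andP[]]].
have [d d0 dP] := loc _ sT.
have d20 : 0 < d / 2 by rewrite divr_gt0.
have [s Ss ltsup] := sup_adherent d20 supS.
have sle : s <= sup S by exact: ub_le_sup.
have [/andP[s0 leT] gs] := Ss.
have sd : `|s - sup S| < d by rewrite ler0_norm; lra.
have step l : 0 < l < d -> s + l <= T -> S (s + l).
  move=> /[dup] ld /andP[l0 _] slT; split; first by apply/andP; split; lra.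
  have := dP s l sd ld s0 slT; rewrite mulrDr; lra.
(* If [T] is within [d] of [s], one step reaches [T]; otherwise a step of [d / 2] lands beyond
   [sup S], a contradiction. *)
have [Tlt|Tge] := ltP (T - s) d.
  have [->|sneq] := eqVneq T s; first by [].
  have : S (s + (T - s)).
    apply: step; last lra.
    by apply/andP; split=> //; rewrite subr_gt0 lt_neqAle eq_sym sneq.
  by rewrite addrC subrK => -[].
have : S (s + d / 2) by apply: step; lra.
by move/(ub_le_sup ubS); lra.
Qed.

(** A nonnegative liminf only yields a set of the filter on which the quotients exceed [- e]; [N]
    and [d] come from a product set inside it. *)
Lemma clarke_low_ge0P (R : realType) (n : nat) (Z : set 'rV[R]_n)
    (phi : 'rV[R]_n -> R) (z : 'rV[R]_n) (j : 'I_n) (e : R) : 0 < e ->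
  (0 <= clarke_low Z phi z j)%E ->
  exists (N : set 'rV[R]_n) (d : R), [/\ nbhs z N, 0 < d &
    forall t l, N t -> 0 < l < d -> Z t -> Z (t + l *: delta_mx 0 j) ->
      - e * l <= phi (t + l *: delta_mx 0 j) - phi t].
Proof.
move=> e0; rewrite /clarke_low limf_einfE => low0.
have : ((- e)%:E < ereal_sup
    [set ereal_inf (diff_quot phi j @` V) | V in clarke_filter Z z j])%E.
  by apply: lt_le_trans low0; rewrite lte_fin oppr_lt0.
move/ereal_sup_gt => [_ [A [[N Q] /= [zN Q0] NQ] <-] eA].
have [d /= d0 dQ] := Q0.
exists N, d; split=> // t l Nt /andP[l0 ld] Zt Ztl.
have Atl : A (t, l).
  apply: NQ => //; split=> //=.
  by apply: dQ => //=; rewrite sub0r normrN gtr0_norm.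
have : ((- e)%:E <= diff_quot phi j (t, l))%E.
  by apply: (le_trans (ltW eA)); apply: ereal_inf_lbound; exists (t, l).
by rewrite lee_fin /= ler_pdivlMr.
Qed.

Lemma clarke_low_ge0_monotone1 (R : realType) (n : nat) (B : 'I_n -> interval R)
    (phi : 'rV[R]_n -> R) (j : 'I_n) (u : 'rV[R]_n) (T : R) :
  (forall z, box B z -> (0 <= clarke_low (box B) phi z j)%E) ->
  0 <= T -> box B u -> box B (u + T *: delta_mx 0 j) ->
  phi u <= phi (u + T *: delta_mx 0 j).
Proof.
move=> low T0 Bu BuT.
have Bseg s : 0 <= s -> s <= T -> box B (u + s *: delta_mx 0 j).
  move=> s0 sT k; have := Bu k; have := BuT k; rewrite !mxE.
  case: (k == j); last by rewrite !mulr0.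
  rewrite andbT !mulr1 => Bk1 Bk0; apply: (interval_is_interval Bk0 Bk1).
  by rewrite lerDl s0 lerD2l.
have ray : continuous (fun s : R => u + s *: delta_mx 0 j).
  by move=> s; apply: cvgD; [exact: cvg_cst | apply: cvgZr_tmp; exact: cvg_id].
(* The slope [- e / (T + 1)] loses at most [e] over length [T], and [T + 1] is positive even when
   [T] is 0. *)
suff H e : 0 < e -> - e * T <= phi (u + T *: delta_mx 0 j) - phi u.
  rewrite -subr_ge0; apply/ler_addgt0Pl => e e0.
  have T1 : 0 < T + 1 by lra.
  have := H (e / (T + 1)) (divr_gt0 e0 T1).
  have : e / (T + 1) * T <= e.
    by rewrite mulrAC ler_pdivrMr// ler_pM2l//; lra.
  rewrite mulNr; lra.
move=> e0.
have := @local_to_global_increment R (fun s => phi (u + s *: delta_mx 0 j)) T (- e) T0.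
rewrite scale0r addr0; apply => s /andP[s0 sT].
have [N [d [zN d0 NP]]] := clarke_low_ge0P e0 (low _ (Bseg _ s0 sT)).
have [d' /= d'0 d'N] := ray s _ zN.
exists (Num.min d d'); first by rewrite lt_min d0.
move=> t l ts /andP[l0 ld] t0 tlT.
rewrite scalerDl addrA; apply: NP.
- by apply: d'N => /=; rewrite distrC (lt_le_trans ts)// ge_min lexx orbT.
- by rewrite l0 (lt_le_trans ld)// ge_min lexx.
- by apply: Bseg => //; lra.
- by rewrite -addrA -scalerDl; apply: Bseg => //; lra.
Qed.

(** Coordinates are switched from [u] to [v] one at a time; in a product of intervals every mixture
    of the two points stays in the box. *)
Lemma clarke_low_ge0_monotone (R : realType) (n : nat) (B : 'I_n -> interval R)
    (phi : 'rV[R]_n -> R) (u v : 'rV[R]_n) :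
  box B u -> box B v -> (forall j, u 0 j <= v 0 j) ->
  (forall j, u 0 j != v 0 j ->
     forall z, box B z -> (0 <= clarke_low (box B) phi z j)%E) ->
  phi u <= phi v.
Proof.
move=> Bu Bv uv low.
pose w (s : seq 'I_n) : 'rV[R]_n := \row_j (if j \in s then v 0 j else u 0 j).
have Bw s : box B (w s) by move=> j; rewrite mxE; case: ifP.
suff H (s : seq 'I_n) : phi u <= phi (w s).
  rewrite [v](_ : _ = w (enum 'I_n)); first exact: H.
  by apply/rowP => j; rewrite mxE mem_enum.
elim: s => [|j s IH].
  by rewrite [w _](_ : _ = u)//; apply/rowP => j; rewrite mxE in_nil.
apply: (le_trans IH).
have [js|js] := boolP (j \in s).
  rewrite [w (j :: s)](_ : _ = w s)//; apply/rowP => k; rewrite !mxE in_cons.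
  by case: eqP => [->|//]; rewrite js.
have wE : w (j :: s) = w s + (v 0 j - u 0 j) *: delta_mx 0 j.
  apply/rowP => k; rewrite !mxE in_cons /=.
  case: eqP => [->|_] /=; last by rewrite mulr0 addr0.
  by rewrite (negPf js) mulr1 addrC subrK.
have [uvj|uvj] := eqVneq (u 0 j) (v 0 j).
  by rewrite wE uvj subrr scale0r addr0.
rewrite wE; apply: (@clarke_low_ge0_monotone1 _ _ B) => //.
- exact: low.
- by rewrite subr_ge0.
- by rewrite -wE.
Qed.

(** * Linear functions as remainder functions *)

Lemma dotpBr (R : realType) (n : nat) (s u v : 'rV[R]_n) :
  dotp s (u - v) = dotp s u - dotp s v.
Proof.
by rewrite /dotp -sumrB; apply: eq_bigr => j _; rewrite !mxE mulrBr.
Qed.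

(** With [kappa] all ones the inner product expands into terms [s_j d_j d_k], and
    [2 |d_j d_k| <= d_j^2 + d_k^2] bounds each by [|s_j|] times the squared norm of [d]. *)
Lemma ellc_dotp (R : realType) (n : nat) (Z : set 'rV[R]_n) (s : 'rV[R]_n) :
  ellc Z (dotp s).
Proof.
move=> z _; exists setT, (const_mx 1), (\sum_j \sum_(k < n) `|s 0 j|).
split=> [|j|z' z'' _ _]; first by split=> //; exact: openT.
  by rewrite mxE oner_neq0.
rewrite -dotpBr; set d := z' - z''.
have -> : dotp (dotp s d *: const_mx 1) d = \sum_j \sum_k s 0 j * d 0 j * d 0 k.
  rewrite /dotp (eq_bigr (fun k => \sum_j s 0 j * d 0 j * d 0 k)).
    by rewrite exchange_big.
  by move=> k _; rewrite !mxE mulr1 mulr_suml.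
rewrite mulr_suml; apply: ler_sum => j _; rewrite mulr_suml.
apply: ler_sum => k _; rewrite -mulrA.
apply: le_trans (ler_norm _) _; rewrite normrM ler_wpM2l// ler_norml.
have sq l : d 0 l * d 0 l <= dotp d d.
  rewrite /dotp (bigD1 l)//= lerDl; apply: sumr_ge0 => i _.
  by rewrite -expr2 sqr_ge0.
have := sq j; have := sq k.
have := sqr_ge0 (d 0 j + d 0 k); have := sqr_ge0 (d 0 j - d 0 k).
by rewrite !expr2; move=> *; apply/andP; split; nra.
Qed.

Lemma diff_quot_dotp (R : realType) (n : nat) (s t : 'rV[R]_n) (j : 'I_n) (l : R) :
  0 < l -> diff_quot (dotp s) j (t, l) = (s 0 j)%:E.
Proof.
move=> l0; congr (_%:E); rewrite /= /dotp -sumrB (bigD1 j)//= big1 => [|k kj].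
  by rewrite !mxE !eqxx mulr1 addr0; field; rewrite gt_eqF.
by rewrite !mxE (negPf kj) andbF mulr0 addr0 subrr.
Qed.

(** Division by zero makes the quotient 0 at increment 0; on this set the quotient of a linear
    function is constant. *)
Lemma clarke_filter_gt0 (R : realType) (n : nat) (Z : set 'rV[R]_n)
  (z : 'rV[R]_n) (j : 'I_n) : clarke_filter Z z j [set p | 0 < p.2].
Proof.
exists (setT, [set l : R | 0 < l]) => /=.
  by split; [exact: filterT | exact: nbhs_right_gt].
by move=> [t l] [_ /= l0].
Qed.

(** Equality can fail: if [Z] is flat in direction [j], the filter contains the empty set, so the
    upper derivative is [-oo] and the lower one [+oo]. *)
Lemma clarke_up_dotp (R : realType) (n : nat) (Z : set 'rV[R]_n)
    (s z : 'rV[R]_n) (j : 'I_n) : (clarke_up Z (dotp s) z j <= (s 0 j)%:E)%E.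
Proof.
rewrite /clarke_up limf_esupE.
apply: (@le_trans _ _ (ereal_sup (diff_quot (dotp s) j @` [set p | 0 < p.2]))).
  by apply: ereal_inf_lbound; exists [set p | 0 < p.2] => //; exact: clarke_filter_gt0.
by apply: ge_ereal_sup => _ [[t l] /= l0 <-]; rewrite diff_quot_dotp.
Qed.

Lemma clarke_low_dotp (R : realType) (n : nat) (Z : set 'rV[R]_n)
    (s z : 'rV[R]_n) (j : 'I_n) : ((s 0 j)%:E <= clarke_low Z (dotp s) z j)%E.
Proof.
rewrite /clarke_low limf_einfE.
apply: (@le_trans _ _ (ereal_inf (diff_quot (dotp s) j @` [set p | 0 < p.2]))).
  by apply: le_ereal_inf_tmp => _ [[t l] /= l0 <-]; rewrite diff_quot_dotp.
by apply: ereal_sup_ubound; exists [set p | 0 < p.2] => //; exact: clarke_filter_gt0.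
Qed.

(** As upper derivative <= slope <= lower derivative, only the slope itself can lie between the
    lower and the upper one. *)
Lemma remainder_fun_dotp (R : realType) (tm : time_setting) (n : nat)
    (k : 'I_n) (Z : set 'rV[R]_n) (a b : 'I_n -> \bar R) (s : 'rV[R]_n) :
  supp_vec tm k a b s -> remainder_fun tm k Z a b (dotp s).
Proof.
move=> sM; split=> [|z Zz v /= vP]; first exact: ellc_dotp.
suff -> : v = s by [].
apply/rowP => j; have /andP[lo up] := vP j.
apply/eqP; rewrite eq_le -!lee_fin.
by rewrite (le_trans up (clarke_up_dotp _ _ _ _)) (le_trans (clarke_low_dotp _ _ _ _) lo).
Qed.

(* The free value c in Case 1 matters when b_j <= 0: then r_j = 0, and m_j = 0
   would select the corner zh_j although zeta_j = z_j. A negative c avoids this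
   in (i), where m need not be the slope of h; M^c forces c = 0 in (ii). *)
Definition Lvec (R : realType) (tm : time_setting) (n : nat) (k : 'I_n)
    (a b : 'I_n -> \bar R) (c : R) : 'rV[R]_n :=
  \row_j match Lcase_of tm k a b j with
         | Lcase1 => c
         | Lcase2 => fine (a j)
         | Lcase3 => fine (b j)
         | Lcase4 | Lcase5 => 0
         end.

(** * The vectors [Lvec c] and the cases defining f_d^L *)

Section Lvec_theory.
Variables (R : realType) (tm : time_setting) (n : nat) (k : 'I_n).
Variables (a b : 'I_n -> \bar R).
Hypothesis a_lt : forall j, (a j < +oo)%E.
Hypothesis b_gt : forall j, (-oo < b j)%E.
Hypothesis ab_fin : forall j, ~ (a j = -oo%E /\ b j = +oo%E).

Local Notation case_of := (Lcase_of tm k a b).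
Local Notation Lvec := (Lvec tm k a b).

(** The order of the tests gives the strict signs. In Case 2 an infinite [a j] would force [b j]
    infinite, against [ab_fin]; in Case 3 the failed Case 2 test makes [|b j| < |a j|], so [b j] is
    finite. *)
Lemma LcaseP j :
  match case_of j with
  | Lcase1 => special tm k j = false /\ (0 <= a j)%E
  | Lcase2 => exists x, [/\ special tm k j = false, a j = x%:E, x < 0 & (0 < b j)%E]
  | Lcase3 => exists y, [/\ special tm k j = false, b j = y%:E, (a j < 0)%E & 0 <= y]
  | Lcase4 => [/\ special tm k j = false, (a j < 0)%E & (b j < 0)%E]
  | Lcase5 => special tm k j = true
  end.
Proof.
rewrite /Lcase_of; case: ifP => // _.
have [//|a0] := leP 0%E (a j); rewrite (ltW a0) /=.
have [b0|//] := leP 0%E (b j); rewrite /=.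
have [ab|ba] := leP `|a j|%E `|b j|%E.
  move: (@ab_fin j) a0 b0 ab; move: (@a_lt j) (@b_gt j).
  case: (a j) => [x| |]; case: (b j) => [y| |] //= _ _ abf.
  - rewrite !lte_fin !lee_fin => x0 y0; rewrite ltr0_norm// ger0_norm// => xy.
    by exists x; split=> //; lra.
  - by rewrite lte_fin => x0 _ _; exists x.
  - by case: abf.
rewrite (ltW ba); move: b0 ba; move: (@b_gt j).
case: (b j) => [y| |] //=; first by rewrite lee_fin => _ y0 _; exists y.
by move=> _ _; rewrite ltNge leey.
Qed.

(** As r_j >= 0, a negative entry selects [z]; in Cases 3 and 4 the entry equals r_j and selects
    [zh]. *)
Lemma rbnd_le_Lvec c j : c <= 0 ->
  match case_of j with
  | Lcase1 => c < 0 -> (rbnd b j <= (Lvec c 0 j)%:E)%E = false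
  | Lcase2 => (rbnd b j <= (Lvec c 0 j)%:E)%E = false
  | Lcase3 | Lcase4 => (rbnd b j <= (Lvec c 0 j)%:E)%E = true
  | Lcase5 => True
  end.
Proof.
move=> c0; have := LcaseP j; rewrite /rbnd mxE.
case: (case_of j) => //.
- by move=> _ cn; apply/negbTE; rewrite -ltNge lt_max !lte_fin cn orbT.
- move=> [x [_ -> x0 _]]; apply/negbTE.
  by rewrite -ltNge lt_max !lte_fin x0 orbT.
- by move=> [y [_ -> _ y0]]; rewrite ge_max lexx lee_fin.
- by move=> [_ _ bj]; rewrite ge_max lexx (ltW bj).
Qed.

Lemma Lvec_pbnd c j : c <= 0 ->
  match case_of j with
  | Lcase1 | Lcase2 => ((Lvec c 0 j)%:E <= pbnd a j)%E
  | _ => true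
  end.
Proof.
move=> c0; have := LcaseP j; rewrite /pbnd mxE; case: (case_of j) => //.
- by move=> [_ aj]; rewrite le_min lee_fin c0 andbT (le_trans _ aj)// lee_fin.
- by move=> [x [_ -> x0 _]]; rewrite le_min lexx lee_fin ltW.
Qed.

Lemma Lvec_supp_vec c : c <= 0 -> supp_vec tm k a b (Lvec c).
Proof.
move=> c0 j; have := LcaseP j.
have := rbnd_le_Lvec j c0; have := Lvec_pbnd j c0.
rewrite [Lvec c 0 j]mxE; case: (case_of j).
- by move=> ? _ [-> _]; right.
- by move=> ? _ [x [-> *]]; right.
- by move=> _ ? [x [-> *]]; left.
- by move=> _ ? [-> *]; left.
- by move=> _ _ ->.
Qed.

Lemma Lvec0_supp_vec_c : supp_vec_c tm k a b (Lvec 0).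
Proof.
move=> j; have := LcaseP j; rewrite mxE /rbnd /pbnd; case: (case_of j).
- by move=> [-> aj]; right; rewrite min_r.
- by move=> [x [-> -> x0 _]]; right; rewrite min_l// lee_fin ltW.
- by move=> [y [-> -> _ y0]]; left; rewrite max_l// lee_fin.
- by move=> [-> _ bj]; left; rewrite max_r// ltW.
- by move=> ->.
Qed.

Lemma corner_Lvec_neg c (z zh : 'rV[R]_n) : c < 0 ->
  corner tm k b (z 0 k) (Lvec c) z zh = Lzeta tm k a b z zh.
Proof.
move=> c0; apply/rowP => j; have := LcaseP j.
have := rbnd_le_Lvec j (ltW c0); rewrite !mxE; case: (case_of j).
- by move=> /(_ c0) -> [-> _].
- by move=> -> [x [-> *]].
- by move=> -> [x [-> *]].
- by move=> -> [-> *].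
- by move=> _ ->.
Qed.

(** The exception is the tie of the zero entry with r_j = 0 in Case 1; the sign of [a j] is kept for
    the monotonicity argument. *)
Lemma corner_Lvec0 (z zh : 'rV[R]_n) j :
  corner tm k b (z 0 k) (Lvec 0) z zh 0 j = Lzeta tm k a b z zh 0 j \/
  [/\ (0 <= a j)%E, special tm k j = false,
      Lzeta tm k a b z zh 0 j = z 0 j &
      corner tm k b (z 0 k) (Lvec 0) z zh 0 j = zh 0 j].
Proof.
have := LcaseP j; have := rbnd_le_Lvec j (lexx 0).
rewrite !mxE; case: (case_of j).
- by move=> _ [-> aj]; case: ifP => _; [right | left].
- by move=> -> [x [-> *]]; left.
- by move=> -> [x [-> *]]; left.
- by move=> -> [-> *]; left.
- by move=> _ ->; left.
Qed.

(** The corner chosen in Case 1 may depend on [c], but the slope there is 0, so one identity serves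
    both (i) and (ii). *)
Lemma dotp_Lvec0_corner c (z zh : 'rV[R]_n) : c <= 0 ->
  dotp (Lvec 0) (corner tm k b (z 0 k) (Lvec c) zh z
                 - corner tm k b (z 0 k) (Lvec c) z zh)
  = dotp (Lalpha tm k a b - Lbeta tm k a b) (z - zh).
Proof.
move=> c0; apply: eq_bigr => j _; have := LcaseP j.
have := rbnd_le_Lvec j c0; rewrite !mxE; case: (case_of j).
- by move=> _ _; rewrite subrr !mul0r.
- move=> -> [x [-> -> x0 _]] /=; rewrite ltr0_norm//; ring.
- move=> -> [y [-> -> _ y0]] /=; rewrite ger0_norm//; ring.
- by move=> _ _; rewrite subrr !mul0r.
- by move=> _ _; rewrite subrr !mul0r.
Qed.

(** Slope and supporting vector differ only in Case 1, where p_j = 0 and the slope 0 still satisfies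
    the upper bound. *)
Lemma corresponds_Lvec c (Z : set 'rV[R]_n) : c < 0 ->
  corresponds tm k Z a b (dotp (Lvec 0)) (Lvec c).
Proof.
move=> c0 j /negPf spF.
have := LcaseP j; have := rbnd_le_Lvec j (ltW c0).
have := rbnd_le_Lvec j (lexx 0); have := Lvec_pbnd j (lexx 0).
case: (case_of j).
- by move=> p0 _ /(_ c0) -> _ z _; apply: le_trans p0; exact: clarke_up_dotp.
- by move=> p0 _ -> _ z _; apply: le_trans p0; exact: clarke_up_dotp.
- by move=> _ r0 -> _ z _; rewrite (le_trans _ (clarke_low_dotp _ _ _ _))// r0.
- by move=> _ r0 -> _ z _; rewrite (le_trans _ (clarke_low_dotp _ _ _ _))// r0.
- by rewrite spF.
Qed.

Lemma fL_fd c (phi : 'rV[R]_n -> R) (z zh : 'rV[R]_n) : c < 0 ->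
  fL tm k a b phi z zh = fd tm k b phi (Lvec c) (dotp (Lvec 0)) z zh.
Proof.
move=> c0; rewrite /fd addrAC corner_Lvec_neg//.
rewrite /fL -(@dotp_Lvec0_corner c) ?ltW// addrC; congr (_ + _).
by rewrite dotpBr corner_Lvec_neg.
Qed.

(** * The extrema over M^c *)

(** A vector of M^c is determined by the set of [j] with m_j = r_j, so summing over all such
    patterns bounds [g]. Patterns picking an infinite bound get the default value of [fine] and only
    add nonnegative terms. *)
Lemma supp_vec_c_bounded (g : 'rV[R]_n -> R) :
  exists K, forall m, supp_vec_c tm k a b m -> `|g m| <= K.
Proof.
pose w (F : {ffun 'I_n -> bool}) : 'rV[R]_n := \row_j
  (if special tm k j then 0 else fine (if F j then rbnd b j else pbnd a j)).
exists (\sum_F `|g (w F)|) => m mM.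
have -> : m = w [ffun j => (m 0 j)%:E == rbnd b j].
  apply/rowP => j; have := mM j; rewrite !mxE ffunE.
  case: ifP => [_ //|_]; case: eqP => [<- //|nr [//|<-//]].
by rewrite (bigD1 [ffun j => (m 0 j)%:E == rbnd b j])//= lerDl sumr_ge0.
Qed.

Lemma fR_up_le (phi : 'rV[R]_n -> R) (z zh m : 'rV[R]_n) :
  supp_vec_c tm k a b m ->
  fR_up tm k a b phi z zh <= fR_val tm k b phi z zh m.
Proof.
move=> mM; have [K KP] := supp_vec_c_bounded (fR_val tm k b phi z zh).
apply: ge_inf; last by exists m.
by exists (- K) => _ [m' /KP + <-]; rewrite ler_norml => /andP[].
Qed.

Lemma le_fR_low (phi : 'rV[R]_n -> R) (z zh m : 'rV[R]_n) :
  supp_vec_c tm k a b m ->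
  fR_val tm k b phi z zh m <= fR_low tm k a b phi z zh.
Proof.
move=> mM; have [K KP] := supp_vec_c_bounded (fR_val tm k b phi z zh).
apply: ub_le_sup; last by exists m.
by exists K => _ [m' /KP + <-]; rewrite ler_norml => /andP[].
Qed.

(** * Comparison of T_R with T_L *)

Section monotone.
Variables (B : 'I_n -> interval R) (phi : 'rV[R]_n -> R).
Hypothesis a_bnd : forall j z, box B z -> (a j <= clarke_low (box B) phi z j)%E.

Lemma box_corner (m z zh : 'rV[R]_n) : box B z -> box B zh ->
  box B (corner tm k b (z 0 k) m z zh).
Proof.
move=> Bz Bzh j; rewrite mxE; case: ifP => [|_]; last by case: ifP.
by rewrite /special; case: tm => // /eqP ->.
Qed.

Lemma box_Lzeta (z zh : 'rV[R]_n) :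
  box B z -> box B zh -> box B (Lzeta tm k a b z zh).
Proof.
move=> Bz Bzh; rewrite -(@corner_Lvec_neg (-1)) ?ltrN10//; exact: box_corner.
Qed.

(** For the competitor [Lvec 0] the linear terms cancel. Where its corner differs from zeta it has
    [zh] in place of [z], hence lies below, and [phi] is nondecreasing there. *)
Lemma fR_up_le_fL (z zh : 'rV[R]_n) :
  box B z -> box B zh -> (forall j, zh 0 j <= z 0 j) ->
  fR_up tm k a b phi z zh <= fL tm k a b phi z zh.
Proof.
move=> Bz Bzh le_z; apply: (le_trans (fR_up_le phi z zh Lvec0_supp_vec_c)).
rewrite /fR_val dotp_Lvec0_corner// lerD2r.
apply: (@clarke_low_ge0_monotone _ _ B); [exact: box_corner|exact: box_Lzeta| |].
  by move=> j; have [-> //|[_ _ -> ->]] := corner_Lvec0 z zh j.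
move=> j; have [->|[aj _ _ _] _ t Bt] := corner_Lvec0 z zh j.
  by rewrite eqxx.
exact: le_trans aj (a_bnd _ Bt).
Qed.

Lemma fL_le_fR_low (z zh : 'rV[R]_n) :
  box B z -> box B zh -> (forall j, z 0 j <= zh 0 j) ->
  fL tm k a b phi z zh <= fR_low tm k a b phi z zh.
Proof.
move=> Bz Bzh le_z; apply: le_trans (le_fR_low phi z zh Lvec0_supp_vec_c).
rewrite /fR_val dotp_Lvec0_corner// lerD2r.
apply: (@clarke_low_ge0_monotone _ _ B); [exact: box_Lzeta|exact: box_corner| |].
  by move=> j; have [-> //|[_ _ -> ->]] := corner_Lvec0 z zh j.
move=> j; have [->|[aj _ _ _] _ t Bt] := corner_Lvec0 z zh j.
  by rewrite eqxx.
exact: le_trans aj (a_bnd _ Bt).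
Qed.

End monotone.
End Lvec_theory.

Lemma box_itv_arg (R : realType) (tm : time_setting) (n : nat) (k : 'I_n)
    (B : 'I_n -> interval R) (xk : R) (z : 'rV[R]_n) :
  (tm = CT -> xk \in B k) -> box B z -> box B (itv_arg tm k xk z).
Proof.
move=> xB Bz j; rewrite mxE; case: ifP => //.
by rewrite /special; case: tm xB => // + /eqP ->; exact.
Qed.


Theorem theorem5 (R : realType) (tm : time_setting) (nx nz : nat)
    (le_n : (nx <= nz)%N) (B : 'I_nz -> interval R)
    (f : 'rV[R]_nz -> 'rV[R]_nx) (a b : 'I_nx -> 'I_nz -> \bar R)
    (f_ellc : forall i, ellc (box B) (component f i))
    (a_lt : forall i j, (a i j < +oo)%E)
    (b_gt : forall i j, (-oo < b i j)%E)
    (ab_fin : forall i j, ~ (a i j = -oo%E /\ b i j = +oo%E))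
    (a_bnd : forall i j z, box B z ->
       (a i j <= clarke_low (box B) (component f i) z j)%E)
    (b_bnd : forall i j z, box B z ->
       (clarke_up (box B) (component f i) z j <= b i j)%E) :
  (forall i : 'I_nx,
     let k := widen_ord le_n i in
     exists (m : 'rV[R]_nz) (h : 'rV[R]_nz -> R),
       [/\ supp_vec tm k (a i) (b i) m,
           remainder_fun tm k (box B) (a i) (b i) h,
           corresponds tm k (box B) (a i) (b i) h m &
           forall z zh, box B z -> box B zh ->
             fL tm k (a i) (b i) (component f i) z zh
             = fd tm k (b i) (component f i) m h z zh])
  /\
  (forall (zl zu : 'rV[R]_nz) (x : 'rV[R]_nx),
     (forall j, zl 0 j <= zu 0 j) ->
     vec_itv zl zu `<=` box B ->
     (tm = CT -> forall i, x 0 i \in B (widen_ord le_n i)) ->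
     TR tm le_n a b f x zl zu `<=` TL tm le_n a b f x zl zu).
Proof.
split=> [i k|zl zu x le_z zB xB v vTR i].
  (* Any negative value in place of -1 would do; the slope of the remainder function keeps 0 in Case
     1. *)
  exists (Lvec tm k (a i) (b i) (-1)), (dotp (Lvec tm k (a i) (b i) 0)).
  have N10 : -1 < 0 :> R by rewrite ltrN10.
  split.
  - by apply: Lvec_supp_vec => //; exact: ltW.
  - by apply: remainder_fun_dotp; exact: Lvec_supp_vec.
  - exact: corresponds_Lvec.
  - by move=> z zh _ _; exact: fL_fd.
have Bzl : box B zl by apply: zB => j; rewrite lexx le_z.
have Bzu : box B zu by apply: zB => j; rewrite lexx le_z.
pose k := widen_ord le_n i; pose arg := itv_arg tm k (x 0 i).
have Barg z : box B z -> box B (arg z).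
  by apply: box_itv_arg => tmCT; exact: xB.
have le_arg j : arg zl 0 j <= arg zu 0 j by rewrite !mxE; case: ifP.
have /andP[lo up] := vTR i; move: lo up; rewrite !mxE => lo up.
apply/andP; split.
  apply: le_trans lo.
  by apply: (@fL_le_fR_low _ _ _ _ _ _ _ _ _ B) => //; [exact: a_bnd | exact: Barg | exact: Barg].
apply: (le_trans up).
by apply: (@fR_up_le_fL _ _ _ _ _ _ _ _ _ B) => //; [exact: a_bnd | exact: Barg | exact: Barg].
Qed.
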